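(* Let $n$ be a positive integer, let $u$ be real with $-\infty<u<1$, let $d,s$ be integers with $0\le d\le s\le n-d$, and let $A$ and $B$ be disjoint $d$-element subsets of $[n]$. Then the vector $v_{d,s}(A,B)$ is an eigenvector of the matrix $\zeta_n(u)$ for the eigenvalue $$\lambda_d=\frac{1}{2^n}\frac{\Gamma\left(\frac52-u\right)\,\Gamma(2+n-d-u)\,\Gamma(1+d-u)}{\Gamma\left(\frac52+\frac n2-u\right)\,\Gamma\left(2+\frac n2-u\right)\,\Gamma(1-u)} .$$
   Context: $[n]=\{1,\dots,n\}$; rows and columns of $2^n\times2^n$ matrices, and coordinates of vectors in $2^n$-dimensional space, are indexed by subsets of $[n]$. For $T\subseteq[n]$, $e_T=(\delta_{S,T})_{S\subseteq[n]}$ is the standard unit vector with a $1$ in coordinate $T$ and $0$ elsewhere. For $I,J\subseteq[n]$ put $n_{\in\in}=|I\cap J|$, $n_{\notin\notin}=|[n]\setminus(I\cup J)|$, $n_{\notin\in}=|J\setminus I|$, $n_{\in\notin}=|I\setminus J|$; $\delta_{i,j}$ is the Kronecker delta. The matrix $\zeta_n(u)=(Z_{IJ})_{I,J\subseteq[n]}$ has entries $$Z_{IJ}=\delta_{n_{\notin\in},n_{\in\notin}}\Big(\tfrac{n-n_{\in\in}-n_{\notin\notin}}{2}\Big)!\;\frac{1}{2^n}\,\frac{\Gamma\left(\frac52-u\right)\,\Gamma\left(2+\frac n2+\frac{n_{\in\in}}2-\frac{n_{\notin\notin}}2-u\right)\,\Gamma\left(2+\frac n2+\frac{n_{\notin\notin}}2-\frac{n_{\in\in}}2-u\right)}{\Gamma\left(\frac52+\frac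 n2-u\right)\,\Gamma\left(2+\frac n2-u\right)\,\Gamma\left(2+\frac n2-\frac{n_{\in\in}}2-\frac{n_{\notin\notin}}2-u\right)} .$$ For disjoint $d$-element subsets $A,B$ of $[n]$ and $0\le d\le s\le n-d$, $$v_{d,s}(A,B)=\sum_{X\subseteq A}\ \sum_{\substack{Y\subseteq[n]\setminus(A\cup B)\\|Y|=s-d}}(-1)^{|X|}\,e_{X\cup X'\cup Y},$$ where $X'$ is the ''complement of $X$ in $B$'': if $X$ consists of the $i_1$-, $i_2$-, $\dots$-largest elements of $A$, $i_1<i_2<\cdots$, then $X'$ consists of all elements of $B$ except for the $i_1$-, $i_2$-, $\dots$-largest elements of $B$. *)

(* Defs.v *)
From HB Require Import structures.
From mathcomp Require Import all_boot all_order all_algebra.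
From mathcomp Require Import all_classical all_reals all_analysis.

Set Implicit Arguments.
Unset Strict Implicit.
Unset Printing Implicit Defensive.

Import Order.TTheory GRing.Theory Num.Theory.

Local Open Scope ring_scope.

(* Euler's integral; it represents the Gamma function only for 0 < x. Every
   argument used below is positive when u < 1. *)
Definition Gamma (R : realType) (x : R) : R :=
  Rintegral lebesgue_measure `]0, +oo[%classic
    (fun t : R => t `^ (x - 1) * expR (- t)).

(* [n] = {1, ..., n} is represented by 'I_n with its order, and the indices
   I, J range over {set 'I_n}. Matrices and vectors with coordinates indexed by
   subsets are matrices of dimension #|{set 'I_n}| = 2 ^ n, the subset T being
   the coordinate enum_rank T. *)

Definition n_in_in n (I J : {set 'I_n}) : nat := #|I :&: J|.
Definition n_out_out n (I J : {set 'I_n}) : nat := #|~: (I :|: J)|.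
Definition n_out_in n (I J : {set 'I_n}) : nat := #|J :\: I|.
Definition n_in_out n (I J : {set 'I_n}) : nat := #|I :\: J|.

(* When the Kronecker delta is nonzero, n - n_in_in - n_out_out is even, so ./2
   is then exact; the natural-number subtractions never truncate. *)
Definition zeta_entry (R : realType) (n : nat) (u : R) (I J : {set 'I_n}) : R :=
  let a : R := (n_in_in I J)%:R in
  let b : R := (n_out_out I J)%:R in
  let h : R := n%:R / 2 in
  (n_out_in I J == n_in_out I J)%:R
  * ((n - n_in_in I J - n_out_out I J)./2)`!%:R
  * (1 / 2 ^+ n)
  * ((Gamma (5 / 2 - u) * Gamma (2 + h + a / 2 - b / 2 - u)
      * Gamma (2 + h + b / 2 - a / 2 - u))
     / (Gamma (5 / 2 + h - u) * Gamma (2 + h - u)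
        * Gamma (2 + h - a / 2 - b / 2 - u))).

Definition zeta (R : realType) (n : nat) (u : R) : 'M[R]_#|{set 'I_n}| :=
  \matrix_(i, j) zeta_entry u (enum_val i) (enum_val j).

Definition unit_vec (R : realType) (n : nat) (T : {set 'I_n}) :
    'cV[R]_#|{set 'I_n}| :=
  \col_i (enum_val i == T)%:R.

(* For x in A, the i >= 1 such that x is the i-th largest element of A. *)
Definition rank_in n (A : {set 'I_n}) (x : 'I_n) : nat :=
  #|[set y in A | (x <= y)%N]|.

(* The set X' attached to X \subset A. *)
Definition compl_in n (A B X : {set 'I_n}) : {set 'I_n} :=
  [set b in B | ~~ [exists x in X, rank_in A x == rank_in B b]].

Definition v_vec (R : realType) (n d s : nat) (A B : {set 'I_n}) :
    'cV[R]_#|{set 'I_n}| :=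
  \sum_(X : {set 'I_n} | X \subset A)
    \sum_(Y : {set 'I_n} | (Y \subset ~: (A :|: B)) && (#|Y| == s - d)%N)
      (-1) ^+ #|X| *: unit_vec R (X :|: compl_in A B X :|: Y).

Definition lambda (R : realType) (n : nat) (u : R) (d : nat) : R :=
  1 / 2 ^+ n
  * ((Gamma (5 / 2 - u) * Gamma (2 + n%:R - d%:R - u) * Gamma (1 + d%:R - u))
     / (Gamma (5 / 2 + n%:R / 2 - u) * Gamma (2 + n%:R / 2 - u)
        * Gamma (1 - u))).

(* M acts on column vectors, whereas mxalgebra's eigenspace concerns row
   vectors. *)
Definition is_eigenvector (R : realType) (m : nat) (M : 'M[R]_m) (a : R)
    (v : 'cV[R]_m) : Prop :=
  v != 0 /\ M *m v = a *: v.

(* Main.v *)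
Require Import Defs.
From HB Require Import structures.
From mathcomp Require Import all_boot all_order all_algebra.
From mathcomp Require Import all_classical all_reals all_analysis.
From mathcomp Require Import measurable_realfun ring lra zify.

(** Write w = 1 - u. On subsets I and J of different sizes an entry of the
    matrix vanishes; on subsets of the same size s it is a constant times
    f(k), where k = #|I \ J| and f(k) = k! / Gamma(w + 1 + k)
    (zeta_entry_level). So each level of the matrix belongs to the Johnson
    scheme, and the claim is the evaluation of one of its eigenvalues.

    The order of [n] pairs the i-th largest element a of A with the i-th
    largest element sigma a of B, and v(I) is, for #|I| = s, the product over
    a in A of [sigma a in I] - [a in I] (sum_supp_set_indicator). A set J in
    the support of v contains exactly one element of each pair, together with
    a set Y of s - d elements of the complement C of A and B. As a function of
    J, #|I \ J| is a sum of one contribution from each pair and of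
    #|(I meet C) \ Y|. Encode a number k by the monomial t^k: the signed sum
    over the choices in the pairs then factors, a pair contributing
    t^[a in I] - t^[sigma a in I] = ([sigma a in I] - [a in I]) (1 - t).
    Decoding turns multiplication by 1 - t into the difference operator
    g(k) - g(k + 1), so that the sum over the pairs is v(I) times the d-th
    difference of f at #|(I meet C) \ Y| (signed_sum_subset). When v(I) is
    nonzero, I meet C has s - d elements, and counting the sets Y gives the
    eigenvalue up to constants (sum_supp_set_diff):
      sum_j  binom(s - d, j) binom(n - s - d, j) (D^d f)(j),
    D being the difference operator.

    Only Gamma(x + 1) = x Gamma(x) and Gamma(x) > 0 for x > 0 enter the
    evaluation. They give
      (D^d f)(j) = Gamma(w + d) / Gamma(w) * j! / Gamma(w + 1 + d + j)
    by induction on d, and a Chu-Vandermonde identity sums the series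
    (iter_neg_diff_fact, Vandermonde_bin_fact). Since Gamma is given by
    Euler's integral, its functional equation is proved first, by an
    integration by parts. *)

Set Implicit Arguments.
Unset Strict Implicit.
Unset Printing Implicit Defensive.

Import Order.TTheory GRing.Theory Num.Theory.
Import numFieldNormedType.Exports.
Local Open Scope ring_scope.

(** * Functional equation and positivity of Euler's integral *)

Section GammaFunction.
Variable R : realType.
Implicit Types x t : R.
Local Open Scope classical_set_scope.
Notation mu := (@lebesgue_measure R).

Definition Gamma_integrand x t : R := t `^ (x - 1) * expR (- t).

(** Extended-real valued, so that the functional equation can be obtained
    before convergence is known, and then be used to prove convergence. *)
Definition Gamma_integral x : \bar R :=
  (\int[mu]_(t in `]0%R, +oo[) (Gamma_integrand x t)%:E)%E.

Lemma Gamma_integrand_ge0 x t : 0 <= Gamma_integrand x t.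
Proof. by rewrite mulr_ge0 ?powR_ge0 ?expR_ge0. Qed.

Lemma continuous_expRN : continuous (fun t : R => expR (- t)).
Proof.
move=> t; apply: continuous_comp; last exact: continuous_expR.
exact: opp_continuous.
Qed.

Lemma continuous_powR_gt0 x t :
  0 < t -> {for t, continuous (fun t : R => t `^ x)}.
Proof.
move=> t0; apply: differentiable_continuous; apply/derivable1_diffP.
by apply: derivable_powR; rewrite in_itv/= andbT.
Qed.

Lemma continuous_Gamma_integrand x t :
  0 < t -> {for t, continuous (Gamma_integrand x)}.
Proof.
move=> t0; apply: continuousM; first exact: continuous_powR_gt0.
exact: continuous_expRN.
Qed.

Lemma measurable_Gamma_integrand x :
  measurable_fun (`]0, +oo[ : set R) (Gamma_integrand x).
Proof.
apply: open_continuous_measurable_fun => // t.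
rewrite inE/= in_itv/= andbT => t0.
exact: continuous_Gamma_integrand.
Qed.

(* Bounds of an exhaustion of ]0, +oo[ by segments; the shift by 2 makes
   lo n < hi n. *)
Let lo n : R := n.+2%:R^-1.
Let hi n : R := n.+2%:R.

Let lo_gt0 n : 0 < lo n. Proof. by rewrite invr_gt0 ltr0n. Qed.
Let lo_lt_hi n : lo n < hi n.
Proof. by rewrite (@lt_trans _ _ 1)// ?invf_lt1 ?ltr1n ?ltr0n. Qed.

Let Gamma_integral_cvg x :
  (\int[mu]_(t in `[lo n, hi n]) (Gamma_integrand x t)%:E)%E @[n --> \oo]
    --> Gamma_integral x.
Proof.
have E : `]0%R, +oo[%classic = \bigcup_n `[lo n, hi n]%classic.
  apply/seteqP; split => t /=; rewrite in_itv/= andbT; last first.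
    by case=> n _ /=; rewrite in_itv/= => /andP[+ _]; apply: lt_le_trans.
  move=> t0; pose m := maxn (Num.trunc t) (Num.trunc t^-1).
  exists m => //=; rewrite in_itv/=; apply/andP; split.
    rewrite /lo -[leRHS]invrK lef_pV2 ?posrE ?invr_gt0 ?ltr0n//.
    rewrite (le_trans (ltW (truncnS_gt _)))// ler_nat ltnS leqW//.
    exact: leq_maxr.
  rewrite /hi (le_trans (ltW (truncnS_gt _)))// ler_nat ltnS leqW//.
  exact: leq_maxl.
rewrite /Gamma_integral E.
apply: ge0_nondecreasing_set_cvg_integral => //.
- move=> m n mn; apply/subsetPset => t /=; rewrite !in_itv/=.
  move=> /andP[lot thi]; apply/andP; split.
    by rewrite (le_trans _ lot)// lef_pV2 ?posrE ?ltr0n// ler_nat !ltnS.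
  by rewrite (le_trans thi)// ler_nat !ltnS.
- move=> n; apply/measurable_EFinP.
  apply: measurable_funS (measurable_Gamma_integrand x) => //.
  by rewrite E => t ?; exists n.
- by move=> n t _; rewrite lee_fin Gamma_integrand_ge0.
Qed.

Let within_cont n (f : R -> R) : (forall t, 0 < t -> {for t, continuous f}) ->
  {within `[lo n, hi n], continuous f}.
Proof.
move=> cf; apply: continuous_in_subspaceT => t.
by rewrite inE/= in_itv/= => /andP[/(lt_le_trans (lo_gt0 n)) t0 _]; exact: cf.
Qed.

Let Gamma_integral_trunc x n :
  (\int[mu]_(t in `[lo n, hi n]) (Gamma_integrand (x + 1) t) =
   lo n `^ x * expR (- lo n) - hi n `^ x * expR (- hi n)
   + x * \int[mu]_(t in `[lo n, hi n]) (Gamma_integrand x t))%R.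
Proof.
have intG : mu.-integrable `[lo n, hi n] (EFin \o Gamma_integrand x).
  apply: continuous_compact_integrable; first exact: segment_compact.
  by apply: within_cont => t; exact: continuous_Gamma_integrand.
have := @Rintegration_by_parts R (fun t => t `^ x) (fun t => - expR (- t))
  (fun t => x * t `^ (x - 1)) (fun t => expR (- t)) _ _ (lo_lt_hi n).
under eq_Rintegral do rewrite -{1}[x](addrK 1) -/(Gamma_integrand _ _).
move=> -> //.
- under [in LHS]eq_Rintegral do rewrite mulrN -mulrA -/(Gamma_integrand _ _) -mulNr.
  by rewrite RintegralZl//; ring.
- apply: within_cont => t t0; apply: continuousM; first exact: cst_continuous.
  exact: continuous_powR_gt0.
- have c t : 0 < t -> {for t, continuous (fun t => t `^ x)}.
    exact: continuous_powR_gt0.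
  split.
  + move=> t; rewrite in_itv/= => /andP[/(lt_trans (lo_gt0 n)) t0 _].
    by apply: derivable_powR; rewrite in_itv/= andbT.
  + by apply: cvg_at_right_filter; apply: c.
  + by apply: cvg_at_left_filter; apply: c; exact: lt_trans (lo_lt_hi n).
- move=> t; rewrite in_itv/= => /andP[/(lt_trans (lo_gt0 n)) t0 _].
  by apply: powR_derive1; rewrite in_itv/= andbT.
- by apply: within_cont => t _; exact: continuous_expRN.
- have c : continuous (fun t : R => - expR (- t)).
    by move=> t; apply: cvgN; exact: continuous_expRN.
  split.
  + by move=> t _; exact: ex_derive.
  + by apply: cvg_at_right_filter; apply: c.
  + by apply: cvg_at_left_filter; apply: c.
- by move=> t _; rewrite derive1E derive_val mulrN1 opprK.
Qed.

Let lo_cvg0 : lo n @[n --> \oo] --> 0.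
Proof.
have := @cvg_harmonic R; rewrite -cvg_shiftS; exact.
Qed.

Let boundary_cvg0 x : 0 < x ->
  (lo n `^ x * expR (- lo n) - hi n `^ x * expR (- hi n))%R @[n --> \oo]
    --> (0 : R).
Proof.
move=> x0; rewrite -[X in _ --> X]subr0; apply: cvgB.
  rewrite -[X in _ --> X](mul0r 1); apply: cvgM.
    apply: (@cvg_comp _ _ _ lo (fun t => t `^ x) _ (0 : R)^'+);
      last exact: powR_cvg0.
    move=> A [e /= e0 eA]; have /cvgrPdist_lt/(_ _ e0)[N _ NA] := lo_cvg0.
    by exists N => // n /NA /= ?; exact: eA.
  rewrite -expR0 -oppr0.
  apply: (@cvg_comp _ _ _ lo (fun t => expR (- t)) _ (nbhs (0 : R))).
    exact: lo_cvg0.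
  exact: continuous_expRN.
(* With m + 1 >= x, the bound expR t >= t ^+ (m + 2) / (m + 2)! gives
   t `^ x * expR (- t) <= (m + 2)! / t for t >= 1. *)
pose m := Num.trunc x.
apply: (@squeeze_cvgr _ _ _ _ (cst 0) (fun n => m.+2`!%:R * lo n)).
- apply: nearW => n; rewrite mulr_ge0 ?powR_ge0 ?expR_ge0//=.
  have h1 : 1 <= hi n by rewrite ler1n.
  have h0 : 0 < hi n by rewrite ltr0n.
  rewrite expRN ler_pdivrMr ?expR_gt0//.
  apply: (@le_trans _ _ (hi n ^+ m.+1)).
    by rewrite -(powR_mulrn _ (ltW h0)) ler_powR//; exact: ltW (truncnS_gt _).
  have /(le_trans (ler_wpDl ler01 (lexx _))) :=
    @expR_ge1Dxn R (hi n) m.+1 (ltW h0).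
  rewrite ler_pdivrMr ?ltr0n ?fact_gt0// => h.
  by rewrite mulrAC ler_pdivlMr// -exprSr mulrC.
- exact: cvg_cst.
- rewrite -[X in _ --> X](mulr0 m.+2`!%:R); apply: cvgM; first exact: cvg_cst.
  exact: lo_cvg0.
Qed.

(** Integration by parts on the segments [lo n, hi n]: the boundary terms
    tend to 0 and, the integrands being nonnegative, the truncated integrals
    tend to the full ones even if those are infinite. *)
Lemma Gamma_integralS x : 0 < x ->
  Gamma_integral (x + 1) = (x%:E * Gamma_integral x)%E.
Proof.
move=> x0; apply: (cvg_unique _ (@Gamma_integral_cvg (x + 1))) => //.
have fin y n : (\int[mu]_(t in `[lo n, hi n]) (Gamma_integrand y t)%:E)%E
    = (\int[mu]_(t in `[lo n, hi n]) Gamma_integrand y t)%R%:E.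
  rewrite /Rintegral fineK//; apply: integrable_fin_num => //.
  apply: continuous_compact_integrable; first exact: segment_compact.
  by apply: within_cont => t; exact: continuous_Gamma_integrand.
rewrite -[(x%:E * _)%E]add0e /=.
under eq_cvg do rewrite fin Gamma_integral_trunc EFinD EFinM -fin.
apply: cvgeD.
- by rewrite fin_num_adde_defr.
- by apply: cvg_EFin; [exact: nearW|exact: boundary_cvg0].
- by apply: cvgeZl => //; exact: Gamma_integral_cvg.
Qed.

Lemma Gamma_integral1 : Gamma_integral 1 = 1%E.
Proof.
rewrite /Gamma_integral.
under eq_integral do rewrite /Gamma_integrand subrr powRr0 mul1r.
rewrite integral_itv_obnd_cbnd; last first.
  apply/measurable_EFinP; apply: measurable_funTS.
  by apply: continuous_measurable_fun; exact: continuous_expRN.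
rewrite (@ge0_continuous_FTC2y _ _ (fun t => - expR (- t)) _ 0).
- by rewrite oppr0 expR0 EFinN oppeK add0e.
- by move=> t _; exact: expR_ge0.
- by apply: continuous_subspaceT; exact: continuous_expRN.
- by rewrite -oppr0; apply: cvgN; exact: cvgr_expR.
- by move=> t _; exact: ex_derive.
- by apply: cvg_at_right_filter; apply: cvgN; exact: continuous_expRN.
- by move=> t _; rewrite derive1E derive_val mulrN1 opprK.
Qed.

Lemma Gamma_integral_nat n : Gamma_integral n.+1%:R = n`!%:R%:E.
Proof.
elim: n => [|n IH]; first by rewrite Gamma_integral1.
by rewrite -[n.+2%:R]natr1 Gamma_integralS ?ltr0n// IH -EFinM -natrM factS.
Qed.

(** At integers the value is a factorial; an exponent y >= 1 is dominated by
    integers, as t `^ (y - 1) is at most 1 for t <= 1 and at most a natural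
    power of t for t >= 1; the functional equation brings any x > 0 to
    x + 1. *)
Lemma Gamma_integral_lty x : 0 < x -> (Gamma_integral x < +oo)%E.
Proof.
have big y : 1 <= y -> (Gamma_integral y < +oo)%E.
  move=> y1; pose m := Num.trunc y.
  have mE z : measurable_fun (`]0, +oo[ : set R) (EFin \o Gamma_integrand z).
    by apply/measurable_EFinP; exact: measurable_Gamma_integrand.
  have le : (Gamma_integral y <= Gamma_integral 1 + Gamma_integral m.+2%:R)%E.
    rewrite /Gamma_integral -ge0_integralD//; first last.
    - exact: mE.
    - by move=> t _; rewrite lee_fin Gamma_integrand_ge0.
    - exact: mE.
    - by move=> t _; rewrite lee_fin Gamma_integrand_ge0.
    apply: ge0_le_integral => //.
    - by move=> t _; rewrite lee_fin Gamma_integrand_ge0.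
    - exact: mE.
    - by apply: emeasurable_funD; exact: mE.
    move=> t /=; rewrite in_itv/= andbT => t0.
    rewrite -EFinD lee_fin /Gamma_integrand -mulrDl ler_wpM2r ?expR_ge0//.
    rewrite subrr powRr0.
    have [t1|/ltW t1] := leP t 1.
      rewrite (le_trans (y := 1)) ?lerDl ?powR_ge0//.
      have : t `^ (y - 1) <= 1 `^ (y - 1).
        by rewrite ge0_ler_powR ?nnegrE ?subr_ge0// ltW.
      by rewrite powR1.
    rewrite (le_trans (y := t `^ (m.+2%:R - 1))) ?lerDr//.
    rewrite ler_powR// lerD2r (le_trans (ltW (truncnS_gt _)))// ler_nat.
    exact: leqnSn.
  apply: le_lt_trans le _.
  by rewrite Gamma_integral_nat Gamma_integral1 -EFinD ltry.
move=> x0; have := big (x + 1); rewrite lerDr ltW// => /(_ isT).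
rewrite Gamma_integralS//; case: (Gamma_integral x) => [r||]; rewrite ?ltry//.
by rewrite gt0_muley// lte_fin.
Qed.

(** For y >= 1 the integrand is at least expR (- 2) on [1, 2]; the functional
    equation brings any x > 0 to x + 1. *)
Lemma Gamma_integral_gt0 x : 0 < x -> (0 < Gamma_integral x)%E.
Proof.
have big y : 1 <= y -> (0 < Gamma_integral y)%E.
  move=> y1.
  have mE z : measurable_fun (`]0, +oo[ : set R) (EFin \o Gamma_integrand z).
    by apply/measurable_EFinP; exact: measurable_Gamma_integrand.
  apply: (@lt_le_trans _ _ (\int[mu]_(t in `[1%R, 2%R]) (expR (- 2))%:E)%E).
    rewrite integral_cst//= lebesgue_measure_itv/= lte_fin ltr1n.
    by rewrite -EFinB -EFinM lte_fin mulr_gt0 ?expR_gt0//; lra.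
  have sub : (`[1, 2] : set R) `<=` (`]0, +oo[ : set R).
    by move=> t /=; rewrite !in_itv/= andbT => /andP[+ _]; exact: lt_le_trans.
  apply: (@le_trans _ _ (\int[mu]_(t in `[1%R, 2%R]) (Gamma_integrand y t)%:E)%E).
    apply: ge0_le_integral => //.
    - by apply: measurable_funS (mE _).
    move=> t /=; rewrite in_itv/= => /andP[t1 t2].
    rewrite lee_fin -[leLHS]mul1r ler_pM ?expR_ge0 ?ler_expR ?lerN2//.
    by rewrite -[leLHS](powRr0 t) ler_powR// subr_ge0.
  apply: ge0_subset_integral => //; first exact: mE.
  by move=> t _; rewrite lee_fin Gamma_integrand_ge0.
move=> x0; have := big (x + 1); rewrite lerDr ltW// => /(_ isT).
by rewrite Gamma_integralS// pmule_rgt0// lte_fin.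
Qed.

(** Gamma takes the finite part of the integral, which would be 0 if the
    integral diverged. *)
Lemma Gamma_fineK x : 0 < x -> (Gamma x)%:E = Gamma_integral x.
Proof.
move=> x0; rewrite /Gamma /Rintegral fineK// fin_numElt.
rewrite (lt_trans _ (Gamma_integral_gt0 x0)) ?ltNyr//=.
exact: Gamma_integral_lty.
Qed.

Lemma Gamma_gt0 x : 0 < x -> 0 < Gamma x.
Proof. by move=> x0; rewrite -lte_fin Gamma_fineK// Gamma_integral_gt0. Qed.

Lemma GammaS x : 0 < x -> Gamma (x + 1) = x * Gamma x.
Proof.
move=> x0; apply: EFin_inj.
by rewrite EFinM !Gamma_fineK ?addr_gt0// Gamma_integralS.
Qed.

End GammaFunction.

(* The finite-set lemmas take precedence over their classical-set homonyms. *)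
Import fintype mathcomp.boot.finset.

(** * Sums over a solution of the functional equation *)

Definition neg_diff (V : zmodType) (g : nat -> V) (k : nat) : V := g k - g k.+1.

Lemma iter_neg_diff_shift (V : zmodType) (g : nat -> V) d c k :
  iter d (@neg_diff V) (fun i => g (i + c)%N) k =
  iter d (@neg_diff V) g (k + c)%N.
Proof. by elim: d k => //= d IH k; rewrite /neg_diff !IH addSn. Qed.

Section FunctionalEquation.
Variables (R : realFieldType) (G : R -> R).
Hypothesis G_gt0 : forall x, 0 < x -> 0 < G x.
Hypothesis GS : forall x, 0 < x -> G (x + 1) = x * G x.
Implicit Types c w : R.

(** A form of the Chu-Vandermonde identity. Calling the left-hand side
    S(p, q, c), Pascal's rule on binom(p + 1, j) and
    binom(q, j + 1) (j + 1) = q binom(q - 1, j) give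
    S(p + 1, q, c) = S(p, q, c) + q S(p, q - 1, c + 1),
    and the right-hand side satisfies the same recursion. *)
Lemma Vandermonde_bin_fact p q c : 0 < c ->
  \sum_(j < p.+1) ('C(p, j) * 'C(q, j) * j`!)%:R / G (c + j%:R)
    = G (c + p%:R + q%:R) / (G (c + p%:R) * G (c + q%:R)).
Proof.
elim: p q c => [|p IH] q c c0.
  have G0 : G c != 0 by rewrite gt_eqF ?G_gt0.
  have Gq : G (c + q%:R) != 0 by rewrite gt_eqF ?G_gt0// ltr_wpDr.
  rewrite big_ord1 !bin0 fact0 !addr0; field; exact/andP.
have G0 k : G (c + k%:R) != 0 by rewrite gt_eqF ?G_gt0// ltr_wpDr.
have step : \sum_(j < p.+2) ('C(p.+1, j) * 'C(q, j) * j`!)%:R / G (c + j%:R)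
    = \sum_(j < p.+1) ('C(p, j) * 'C(q, j) * j`!)%:R / G (c + j%:R)
    + q%:R * \sum_(j < p.+1) ('C(p, j) * 'C(q.-1, j) * j`!)%:R
                              / G (c + 1 + j%:R).
  rewrite big_ord_recl /=.
  under eq_bigr do rewrite binS 2!mulnDl natrD mulrDl.
  rewrite big_split /= addrA; congr (_ + _).
    rewrite !bin0 -[in RHS](big_mkord xpredT
      (fun j => ('C(p, j) * 'C(q, j) * j`!)%:R / G (c + j%:R))).
    rewrite big_ord_recr /= bin_small// mul0n mul0n mul0r.
    rewrite big_nat_recl//= !bin0 big_mkord; congr (_ + _); by rewrite addr0.
  rewrite mulr_sumr; apply: eq_bigr => j _.
  rewrite /bump /= add1n -[j.+1%:R]natr1 -addrA [1 + _]addrC mulrA -natrM factS.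
  congr (_%:R / _).
  transitivity ('C(p, j) * (q * 'C(q.-1, j)) * j`!)%N; last by ring.
  by rewrite mul_bin_diag; ring.
rewrite step (IH _ _ c0).
case: q {step} => [|q].
  rewrite mul0r !addr0.
  have := G0 0%N; have := G0 p.+1; have := G0 p; rewrite addr0.
  move: (G c) (G _) (G _) => x y z x0 y0 z0.
  by field; rewrite x0 y0 z0.
rewrite (IH _ _ (addr_gt0 c0 ltr01)) /=.
have E1 : c + 1 + p%:R = c + p.+1%:R by rewrite -[p.+1%:R]natr1; ring.
have E2 : c + 1 + q%:R = c + q.+1%:R by rewrite -[q.+1%:R]natr1; ring.
have E3 : c + p.+1%:R = (c + p%:R) + 1 by rewrite -[p.+1%:R]natr1; ring.
have E4 : c + p.+1%:R + q.+1%:R = c + p%:R + q.+1%:R + 1.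
  by rewrite -[p.+1%:R]natr1; ring.
have E5 : c + p.+1%:R + q%:R = c + p%:R + q.+1%:R.
  by rewrite -[p.+1%:R]natr1 -[q.+1%:R]natr1; ring.
rewrite E1 E2 E5 E4 [in RHS]GS ?ltr_wpDr//.
have Ep : G (c + p.+1%:R) = (c + p%:R) * G (c + p%:R).
  by rewrite E3 GS ?ltr_wpDr.
rewrite Ep.
have cp : c + p%:R != 0 by rewrite gt_eqF// ltr_wpDr.
have := G0 p; have := G0 q.+1; move: (G (c + p%:R)) (G (c + q.+1%:R)).
by move=> x y x0 y0; field; rewrite x0 y0 cp.
Qed.

(** One difference multiplies by the next factor of a rising factorial:
    k! / G(x + k) - (k + 1)! / G(x + k + 1) = (x - 1) k! / G(x + 1 + k). *)
Lemma iter_neg_diff_fact w d k : 0 < w ->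
  iter d (@neg_diff R) (fun j => j`!%:R / G (w + 1 + j%:R)) k
    = G (w + d%:R) / G w * (k`!%:R / G (w + 1 + d%:R + k%:R)).
Proof.
move=> w0; elim: d k => [|d IH] k /=.
  by rewrite !addr0 divff ?mul1r// gt_eqF ?G_gt0.
rewrite {1}/neg_diff !IH.
have E1 : w + 1 + d%:R + k.+1%:R = w + 1 + d%:R + k%:R + 1.
  by rewrite -[k.+1%:R]natr1; ring.
have E2 : w + 1 + d.+1%:R + k%:R = w + 1 + d%:R + k%:R + 1.
  by rewrite -[d.+1%:R]natr1; ring.
have E3 : w + d.+1%:R = w + d%:R + 1 by rewrite -[d.+1%:R]natr1; ring.
have p1 : 0 < w + 1 + d%:R + k%:R by rewrite !ltr_wpDr.
have p2 : 0 < w + d%:R by rewrite !ltr_wpDr.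
rewrite E1 E2 E3 !GS// factS natrM -[k.+1%:R]natr1.
have := G_gt0 p1; have := G_gt0 p2; have := G_gt0 w0.
move=> /gt_eqF/negbT h1 /gt_eqF/negbT h2 /gt_eqF/negbT h3.
by field; rewrite h1 h3 gt_eqF.
Qed.

End FunctionalEquation.

(** * Signed sums over subsets as iterated differences *)

Section Umbral.
Variable K : comNzRingType.
Implicit Types (g : nat -> K) (P Q : {poly K}).

(** The linear functional on polynomials that sends the monomial 'X^k to
    g k. *)
Definition umbral g P : K := \sum_(i < size P) P`_i * g i.

Lemma umbral_widen g P N : (size P <= N)%N ->
  umbral g P = \sum_(i < N) P`_i * g i.
Proof.
move=> PN; rewrite /umbral (big_ord_widen N (fun i => P`_i * g i) PN).
rewrite big_mkcond /=; apply: eq_bigr => i _.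
by case: ltnP => // iP; rewrite nth_default ?mul0r.
Qed.

Fact umbral_is_linear g : scalar (umbral g).
Proof.
move=> a P Q.
pose N := maxn (size P) (maxn (size Q) (size (a *: P + Q))).
rewrite !(@umbral_widen _ _ N) ?leq_max ?leqnn ?orbT//.
rewrite mulr_sumr -big_split /=; apply: eq_bigr => i _.
by rewrite coefD coefZ mulrDl mulrA.
Qed.
HB.instance Definition _ g :=
  GRing.isLinear.Build K {poly K} K *%R (umbral g) (umbral_is_linear g).

Lemma umbralXn g k : umbral g 'X^k = g k.
Proof.
rewrite /umbral size_polyXn big_ord_recr /= coefXn eqxx mul1r big1 ?add0r// => i _.
by rewrite coefXn ltn_eqF ?mul0r.
Qed.

Lemma umbral_mul1subX g P : umbral g ((1 - 'X) * P) = umbral (neg_diff g) P.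
Proof.
rewrite mulrBl mul1r linearB /= (@umbral_widen g ('X * P) (size P).+1); last first.
  by rewrite mulrC (leq_trans (size_polyMleq _ _))// size_polyX addn2.
rewrite big_ord_recl /= coefXM /= mul0r add0r /umbral -sumrB.
by apply: eq_bigr => i _; rewrite coefXM /= mulrBr.
Qed.

Lemma umbral_expr1subX g d : umbral g ((1 - 'X) ^+ d) = iter d (@neg_diff K) g 0.
Proof.
elim: d g => [|d IH] g; first by rewrite expr0 -(expr0 'X) umbralXn.
by rewrite exprS umbral_mul1subX IH iterSr.
Qed.

Variable T : finType.
Implicit Types A X : {set T}.

Lemma prodrD_subset A (F G : T -> K) :
  \prod_(i in A) (F i + G i) =
  \sum_(X : {set T} | X \subset A) \prod_(i in A) (if i \in X then F i else G i).
Proof.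
rewrite big_mkcond /=.
rewrite (eq_bigr (fun i => (if i \in A then F i else 0) + (if i \in A then G i else 1)));
  last by move=> i _; case: ifP => _; rewrite ?add0r.
rewrite bigA_distr [RHS]big_mkcond /=; apply: eq_bigr => X _.
case: ifPn => [XA|/subsetPn[x xX xA]].
  rewrite [RHS]big_mkcond /=; apply: eq_bigr => i _.
  by case: (boolP (i \in A)) => // /(contra (subsetP XA i)) /negbTE ->.
by rewrite (bigD1 x)//= xX (negbTE xA) mul0r.
Qed.

Lemma sign_card_prod A X : X \subset A ->
  (-1) ^+ #|X| = \prod_(a in A) (if a \in X then -1 else 1) :> K.
Proof.
move=> /subsetP XA; rewrite -big_mkcondr /= (eq_bigl (mem X)) ?prodr_const//.
by move=> a /=; rewrite andb_idl//; exact: XA.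
Qed.

End Umbral.

(** The signed sum of the polynomials 'X^k, k being the argument of g, is the
    product over A of 'X^(q a) - 'X^(p a). For booleans this difference is
    (p a - q a) (1 - 'X), and (1 - 'X)^d acts as a d-fold difference. *)
Lemma signed_sum_subset (K : comNzRingType) (T : finType) (A : {set T})
    (p q : T -> bool) (g : nat -> K) :
  \sum_(X : {set T} | X \subset A)
     (-1) ^+ #|X| * g (\sum_(a in A) (if a \in X then p a else q a))%N
  = \prod_(a in A) ((p a)%:R - (q a)%:R) * iter #|A| (@neg_diff K) g 0.
Proof.
have E (X : {set T}) : X \subset A ->
    (-1) ^+ #|X| * g (\sum_(a in A) (if a \in X then p a else q a))%N
    = umbral g (\prod_(a in A) if a \in X then - 'X^(p a) else 'X^(q a)).
  move=> XA; rewrite -(umbralXn g) -scalarZ /=; congr (umbral g _).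
  rewrite -mul_polyC rmorphXn /= polyCN polyC1 (sign_card_prod _ XA) -prodrXr.
  rewrite -big_split /=; apply: eq_bigr => a _.
  by case: (a \in X); rewrite ?mulN1r ?mul1r.
rewrite (eq_bigr _ E) -linear_sum /= -prodrD_subset.
have -> : \prod_(i in A) (- 'X^(p i) + 'X^(q i)) =
   (\prod_(a in A) ((p a)%:R - (q a)%:R)) *: (1 - 'X : {poly K}) ^+ #|A|.
  rewrite -mul_polyC rmorph_prod -prodr_const -big_split /=.
  apply: eq_bigr => a _; rewrite polyCB.
  by case: (p a); case: (q a); rewrite ?expr0 ?expr1 /=; ring.
by rewrite linearZ /= umbral_expr1subX.
Qed.

(** * Subsets of given size and given difference from a fixed one *)

Section CountSubsets.
Variables (T : finType) (C W : {set T}).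
Hypothesis WC : W \subset C.

(** Y is determined by the j elements that it drops from W and the j elements
    that it adds from C outside W. *)
Lemma card_equal_size_diff j :
  #|[set Y : {set T} | [&& Y \subset C, #|Y| == #|W| & #|W :\: Y| == j]]|
   = ('C(#|W|, j) * 'C(#|C| - #|W|, j))%N.
Proof.
pose D1 := [set U : {set T} | U \subset W & #|U| == j].
pose D2 := [set V : {set T} | V \subset C :\: W & #|V| == j].
have <- : #|setX D1 D2| = ('C(#|W|, j) * 'C(#|C| - #|W|, j))%N.
  by rewrite cardsX !cards_draws cardsD (setIidPr WC).
have sz (Y : {set T}) : (#|Y| == #|W|) = (#|Y :\: W| == #|W :\: Y|).
  by rewrite -(cardsID W Y) -(cardsID Y W) setIC eqn_add2l.
pose f (U : {set T} * {set T}) := (W :\: U.1) :|: U.2.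
have fK : {in setX D1 D2, cancel f (fun Y => (W :\: Y, Y :\: W))}.
  move=> [U V]; rewrite !inE /=.
  move=> /andP[/andP[/subsetP UW _] /andP[/subsetP VC _]].
  congr (_, _); apply/setP => x; have := UW x; have := VC x;
    rewrite /f !inE/=; by case: (x \in U); case: (x \in V); case: (x \in W);
    case: (x \in C) => //=; intuition.
rewrite -(card_in_imset (can_in_inj fK)); congr #|pred_of_set _|.
apply/setP => Y; rewrite !inE; apply/and3P/imsetP.
  move=> [YC]; rewrite sz => /eqP E /eqP jE.
  exists (W :\: Y, Y :\: W).
    by rewrite !inE /= subsetDl E jE eqxx /= andbT setSD.
  by apply/setP => x; rewrite !inE; case: (x \in Y); case: (x \in W).
move=> [[U V] UV YE]; have := fK _ UV; rewrite -YE => -[UE VE].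
move: UV; rewrite !inE /= => /andP[/andP[UW /eqP Uj] /andP[VC /eqP Vj]].
rewrite sz UE VE Uj Vj eqxx; split => //.
rewrite YE /f subUset (subset_trans (subsetDl _ _) WC).
exact: subset_trans VC (subsetDl _ _).
Qed.

Lemma sum_equal_size_diff (V : nmodType) (g : nat -> V) :
  \sum_(Y : {set T} | (Y \subset C) && (#|Y| == #|W|)) g #|W :\: Y|
  = \sum_(j < #|W|.+1) g j *+ ('C(#|W|, j) * 'C(#|C| - #|W|, j)).
Proof.
have lt (Y : {set T}) : (#|W :\: Y| < #|W|.+1)%N.
  by rewrite ltnS subset_leq_card ?subsetDl.
rewrite (partition_big (fun Y => Ordinal (lt Y)) xpredT)//=; apply: eq_bigr => j _.
rewrite -card_equal_size_diff -sumr_const; apply: eq_big => [Y|Y].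
  by rewrite !inE -val_eqE /= andbA.
by rewrite -val_eqE /= => /andP[_ /eqP ->].
Qed.

End CountSubsets.

(** * The matching of A and B given by ranks *)

Section RankBijection.
Variable n : nat.
Implicit Types A B X : {set 'I_n}.

Lemma rank_in_inj A : {in A &, injective (rank_in A)}.
Proof.
move=> x y; wlog xy : x y / (x <= y)%N => [th|].
  by move=> xA yA E; case: (leqP x y) => [|/ltnW] h; [|apply/esym]; apply: th.
move=> xA yA E; apply/val_inj/eqP; rewrite /= eqn_leq xy /=.
have sub : [set z in A | (y <= z)%N] \subset [set z in A | (x <= z)%N].
  by apply/subsetP => z; rewrite !inE => /andP[-> /(leq_trans xy)].
have : [set z in A | (y <= z)%N] == [set z in A | (x <= z)%N].
  by rewrite eqEcard sub /=; move: E; rewrite /rank_in => ->.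
by move=> /eqP/setP/(_ x); rewrite !inE xA leqnn.
Qed.

(** Ranks are distinct integers between 1 and #|A|, so all of them occur. *)
Lemma mem_rank_in A k :
  (k \in [seq rank_in A x | x <- enum A]) = (0 < k <= #|A|)%N.
Proof.
rewrite -[RHS](_ : (k \in iota 1 #|A|) = _); last by rewrite mem_iota add1n ltnS.
have u : uniq [seq rank_in A x | x <- enum A].
  by rewrite map_inj_in_uniq ?enum_uniq// => x y; rewrite !mem_enum; exact: rank_in_inj.
have [] := uniq_min_size u (s2 := iota 1 #|A|) => [r||_ ->//].
  move=> /mapP[x]; rewrite mem_enum => xA ->; rewrite mem_iota add1n ltnS.
  apply/andP; split; first by rewrite card_gt0; apply/set0Pn; exists x; rewrite inE xA /=.
  by apply/subset_leq_card/subsetP => z; rewrite inE => /andP[].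
by rewrite size_iota size_map -cardE.
Qed.

(** An element of A is matched with the element of B of the same rank. *)
Lemma compl_in_matching A B : #|A| = #|B| ->
  exists sigma : 'I_n -> 'I_n, [/\ {in A &, injective sigma},
    sigma @: A = B &
    forall X, X \subset A -> compl_in A B X = B :\: sigma @: X].
Proof.
move=> AB.
pose sigma a := odflt a [pick b in B | rank_in B b == rank_in A a].
have sigmaP a : a \in A -> sigma a \in B /\ rank_in B (sigma a) = rank_in A a.
  move=> aA; rewrite /sigma; case: pickP => [b /andP[bB /eqP]//|] none.
  have : rank_in A a \in [seq rank_in A x | x <- enum A].
    by apply/mapP; exists a; rewrite ?mem_enum.
  rewrite mem_rank_in AB -mem_rank_in => /mapP[b]; rewrite mem_enum => bB E.
  by have := none b; rewrite bB E eqxx.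
have inj : {in A &, injective sigma}.
  move=> x y xA yA E; apply: (rank_in_inj xA yA).
  by rewrite -(sigmaP x xA).2 -(sigmaP y yA).2 E.
exists sigma; split => //.
  apply/eqP; rewrite eqEcard card_in_imset// AB leqnn andbT.
  by apply/subsetP => _ /imsetP[a aA ->]; exact: (sigmaP a aA).1.
move=> X /subsetP XA; apply/setP => b; rewrite !inE andbC.
case: (boolP (b \in B)) => bB; rewrite ?andbF// !andbT; congr (~~ _).
apply/existsP/imsetP => [[x /andP[xX /eqP E]]|[x xX ->]]; exists x => //.
  apply: (rank_in_inj bB); first exact: (sigmaP x (XA x xX)).1.
  by rewrite (sigmaP x (XA x xX)).2 E.
by rewrite xX (sigmaP x (XA x xX)).2 eqxx.
Qed.

End RankBijection.

(** * The support of the vector *)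

Section Matching.
Variables (T : finType) (A B : {set T}) (sigma : T -> T).
Hypotheses (disjAB : [disjoint A & B]) (sigma_inj : {in A &, injective sigma}).
Hypothesis sigmaA : sigma @: A = B.
Implicit Types I X Y : {set T}.

Let C := ~: (A :|: B).

Definition supp_set X Y := X :|: (B :\: sigma @: X) :|: Y.

(** Counts a set pair by pair, then outside the pairs. *)
Lemma card_matching (S : {set T}) :
  #|S| = (\sum_(a in A) ((a \in S) + (sigma a \in S)) + #|S :&: C|)%N.
Proof.
rewrite -(cardsID (A :|: B) S) -setDE; congr (_ + _)%N.
rewrite setIUr cardsU setIACA (disjoint_setI0 disjAB) setI0 cards0 subn0.
rewrite big_split /=.
have E (D : {set T}) : #|S :&: D| = (\sum_(x in D) (x \in S))%N.
  rewrite -sum1_card big_mkcond [RHS]big_mkcond /=; apply: eq_bigr => x _.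
  by rewrite inE; case: (x \in S); case: (x \in D).
by rewrite !E -sigmaA big_imset.
Qed.

Section SupportSet.
Variables (X Y : {set T}).
Hypotheses (XA : X \subset A) (YC : Y \subset C).

Lemma supp_set_A a : a \in A -> (a \in supp_set X Y) = (a \in X).
Proof.
move=> aA; have aB := disjointFr disjAB aA.
have := subsetP YC a; rewrite /supp_set !inE aA aB andbF orbF /=.
by case: (a \in Y) => [/(_ isT)//|_]; rewrite !orbF.
Qed.

Lemma supp_set_B a : a \in A -> (sigma a \in supp_set X Y) = (a \notin X).
Proof.
move=> aA; have sB : sigma a \in B by rewrite -sigmaA imset_f.
have sA := disjointFl disjAB sB.
have -> : (sigma a \in supp_set X Y) = (sigma a \notin sigma @: X).
  have := subsetP YC (sigma a); have := subsetP XA (sigma a).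
  rewrite /supp_set !inE sA sB /= andbT.
  case: (sigma a \in X) => [/(_ isT)//|_].
  by case: (sigma a \in Y) => [/(_ isT)//|_]; rewrite orbF.
congr (~~ _); apply/imsetP/idP => [[x xX]|aX]; last by exists a.
by move=> /(sigma_inj aA (subsetP XA _ xX)) ->.
Qed.

Lemma supp_set_C x : x \in C -> (x \in supp_set X Y) = (x \in Y).
Proof.
rewrite /supp_set !inE negb_or => /andP[xA xB]; rewrite (negbTE xB) andbF orbF.
by rewrite (contraNF (subsetP XA x) xA).
Qed.

Lemma setI_supp_set : supp_set X Y :&: C = Y.
Proof.
apply/setP => x; rewrite in_setI.
case: (boolP (x \in C)) => xC; first by rewrite andbT supp_set_C.
by rewrite andbF (contraNF (subsetP YC x) xC).
Qed.

Lemma card_supp_set : #|supp_set X Y| = (#|A| + #|Y|)%N.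
Proof.
rewrite card_matching; congr (_ + _)%N.
  rewrite -sum1_card; apply: eq_bigr => a aA.
  by rewrite supp_set_A// supp_set_B//; case: (a \in X).
by rewrite setI_supp_set.
Qed.

Lemma card_setD_supp_set I : #|I :\: supp_set X Y| =
  (\sum_(a in A) (if a \in X then sigma a \in I else a \in I)
   + #|(I :&: C) :\: Y|)%N.
Proof.
rewrite card_matching; congr (_ + _)%N.
  apply: eq_bigr => a aA; rewrite !in_setD supp_set_A// supp_set_B//.
  by case: (a \in X); rewrite ?addn0.
congr #|pred_of_set _|; apply/setP => x; rewrite !(in_setI, in_setD).
case: (boolP (x \in C)) => xC; rewrite ?andbF//.
by rewrite supp_set_C// !andbT.
Qed.

Lemma eq_supp_set I : (I == supp_set X Y) =
  (I :&: C == Y) &&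
  [forall (a | a \in A),
    ((a \in I) == (a \in X)) && ((sigma a \in I) == (a \notin X))].
Proof.
apply/eqP/andP => [->|[/eqP IY /forall_inP IX]].
  split; last by apply/forall_inP => a aA; rewrite supp_set_A// supp_set_B// !eqxx.
  by rewrite setI_supp_set.
apply/setP => x; have [xC|] := boolP (x \in C).
  by rewrite supp_set_C// -IY in_setI xC andbT.
rewrite in_setC negbK in_setU => /orP[xA|].
  by have /andP[/eqP -> _] := IX x xA; rewrite supp_set_A.
rewrite -sigmaA => /imsetP[a aA ->].
by have /andP[_ /eqP ->] := IX a aA; rewrite supp_set_B.
Qed.

End SupportSet.

End Matching.

(** * Sums over the support *)

Section SupportSums.
Variables (K : idomainType) (T : finType) (A B : {set T}) (sigma : T -> T).
Hypotheses (disjAB : [disjoint A & B]) (sigma_inj : {in A &, injective sigma}).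
Hypothesis sigmaA : sigma @: A = B.
Variable m : nat.
Implicit Types I X Y : {set T}.

Let C := ~: (A :|: B).

(** When I has the size of the sets in the support, this is its coordinate in
    the vector: a sign, or 0 if I does not separate some pair. *)
Definition pair_sign I : K :=
  \prod_(a in A) ((sigma a \in I)%:R - (a \in I)%:R).

Lemma pair_sign_card I : pair_sign I != 0 -> #|I| = (#|A| + #|I :&: C|)%N.
Proof.
move/prodf_neq0 => nz; rewrite (card_matching disjAB sigma_inj sigmaA).
congr (_ + _)%N; rewrite -sum1_card; apply: eq_bigr => a /nz.
by case: (a \in I); case: (sigma a \in I) => //; rewrite subrr eqxx.
Qed.

(** For given I at most one pair (X, Y) contributes. The condition on X splits
    over the elements of A, so the sum over X is an expanded product. *)
Lemma sum_supp_set_indicator I :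
  \sum_(X : {set T} | X \subset A)
    \sum_(Y : {set T} | (Y \subset C) && (#|Y| == m))
      (-1) ^+ #|X| * (I == supp_set B sigma X Y)%:R
  = (#|I| == #|A| + m)%N%:R * pair_sign I.
Proof.
pose h X : K := \prod_(a in A)
  if a \in X then ((a \in I) && (sigma a \notin I))%:R
  else ((a \notin I) && (sigma a \in I))%:R.
transitivity (\sum_(X : {set T} | X \subset A)
  (#|I :&: C| == m)%:R * ((-1) ^+ #|X| * h X)).
  apply: eq_bigr => X XA.
  transitivity (\sum_(Y : {set T} | (Y \subset C) && (#|Y| == m))
      (I :&: C == Y)%:R * ((-1) ^+ #|X| * h X)).
    apply: eq_bigr => Y /andP[YC _].
    rewrite (eq_supp_set disjAB sigma_inj sigmaA XA YC) -/C -mulnb natrM mulrCA.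
    congr (_ * (_ * _)).
    rewrite /h; set b := [forall (_ | _), _]; case: (boolP b) => [/forall_inP IX|].
      rewrite big1// => a aA; have /andP[/eqP -> /eqP ->] := IX a aA.
      by case: (a \in X).
    rewrite negb_forall_in => /exists_inP[a aA]; rewrite (bigD1 a)//=.
    by case: (a \in X); case: (a \in I); case: (sigma a \in I) => //=;
      rewrite mul0r.
  rewrite -mulr_suml; congr (_ * _).
  rewrite (eq_bigr (fun Y : {set T} => if Y == I :&: C then 1 else 0)); last first.
    by move=> Y _; rewrite eq_sym; case: eqP.
  rewrite -big_mkcondr /=; case: eqP => E.
    rewrite (big_pred1 (I :&: C))// => Y /=.
    by rewrite andb_idl// => /eqP ->; rewrite subsetIr E eqxx.
  rewrite big_pred0// => Y; apply/negP => /andP[/andP[_ /eqP Ym] /eqP YI].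
  by rewrite -YI in E.
rewrite -mulr_sumr.
have -> : \sum_(X : {set T} | X \subset A) (-1) ^+ #|X| * h X = pair_sign I.
  rewrite /pair_sign (eq_bigr (fun a => - ((a \in I) && (sigma a \notin I))%:R
      + ((a \notin I) && (sigma a \in I))%:R : K)); last first.
    by move=> a _; case: (a \in I); case: (sigma a \in I) => /=; ring.
  rewrite prodrD_subset; apply: eq_bigr => X XA.
  rewrite (sign_card_prod _ XA) -big_split /=; apply: eq_bigr => a _.
  by case: (a \in X); rewrite ?mulN1r ?mul1r.
have [->|nz] := eqVneq (pair_sign I) 0; first by rewrite !mulr0.
by rewrite (pair_sign_card nz) eqn_add2l.
Qed.

(** The sum over X is a signed sum of g over the pairs, shifted by
    #|(I meet C) \ Y|. If the sign of I is nonzero then I meet C has the same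
    size as Y, which makes the count of the sets Y available. *)
Lemma sum_supp_set_diff (g : nat -> K) I : #|I| = (#|A| + m)%N ->
  \sum_(X : {set T} | X \subset A)
    \sum_(Y : {set T} | (Y \subset C) && (#|Y| == m))
      (-1) ^+ #|X| * g #|I :\: supp_set B sigma X Y|
  = pair_sign I * \sum_(j < m.+1)
      iter #|A| (@neg_diff K) g j *+ ('C(m, j) * 'C(#|C| - m, j)).
Proof.
move=> Im; rewrite exchange_big /=.
transitivity (\sum_(Y : {set T} | (Y \subset C) && (#|Y| == m))
   pair_sign I * iter #|A| (@neg_diff K) g #|(I :&: C) :\: Y|).
  apply: eq_bigr => Y /andP[YC _].
  rewrite -[X in iter _ _ _ X]add0n -iter_neg_diff_shift -signed_sum_subset.
  apply: eq_bigr => X XA.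
  by rewrite (card_setD_supp_set disjAB sigma_inj sigmaA XA YC).
rewrite -mulr_sumr.
have [->|nz] := eqVneq (pair_sign I) 0; first by rewrite !mul0r.
have Wm : #|I :&: C| = m.
  by apply/eqP; rewrite -(eqn_add2l #|A|) -(pair_sign_card nz) Im.
congr (_ * _); rewrite -Wm.
exact: (sum_equal_size_diff (subsetIr I C) (iter #|A| (@neg_diff K) g)).
Qed.

End SupportSums.

(** * The matrix on a level, and the eigenvector *)

(* From here on Gamma enters only through its positivity and its functional
   equation. *)
#[local] Opaque Gamma.

Section ZetaLevels.
Variables (R : realType) (n : nat) (u : R).
Implicit Types I J : {set 'I_n}.

(** The factor common to all entries and to all eigenvalues. *)
Definition zeta_const : R :=
  1 / 2 ^+ n * (Gamma (5 / 2 - u)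
    / (Gamma (5 / 2 + n%:R / 2 - u) * Gamma (2 + n%:R / 2 - u))).

Lemma zeta_entry_neq I J : #|I| != #|J| -> zeta_entry u I J = 0.
Proof.
move=> IJ; rewrite /zeta_entry /n_out_in /n_in_out.
suff -> : (#|J :\: I| == #|I :\: J|) = false by rewrite !mul0r.
by apply: contraNF IJ; rewrite -(cardsID J I) -(cardsID I J) setIC eqn_add2l eq_sym.
Qed.

(** With k = #|I \ J| there are s - k elements in both sets and n - s - k in
    neither, so that k cancels in every Gamma factor but the last. *)
Lemma zeta_entry_level I J s : #|I| = s -> #|J| = s ->
  zeta_entry u I J =
  zeta_const * (Gamma (1 - u + 1 + s%:R) * Gamma (1 - u + 1 + n%:R - s%:R))
  * ((#|I :\: J|)`!%:R / Gamma (1 - u + 1 + #|I :\: J|%:R)).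
Proof.
move=> Is Js; rewrite /zeta_entry /n_in_in /n_out_out /n_out_in /n_in_out.
pose k := #|I :\: J|.
have JIk : #|J :\: I| = k.
  by apply/eqP; rewrite -(eqn_add2l #|I :&: J|) {1}setIC /k !cardsID Is Js.
have E1 : (#|I :&: J| + k = s)%N by rewrite /k cardsID.
have E2 : (#|~: (I :|: J)| + s + k = n)%N.
  rewrite -[n in RHS]card_ord -[in RHS](cardsC (I :|: J)) cardsU Is Js; lia.
have -> : ((n - #|I :&: J| - #|~: (I :|: J)|)./2 = k)%N by lia.
rewrite JIk eqxx -/k.
have {}E1 : #|I :&: J|%:R = s%:R - k%:R :> R by rewrite -E1 natrD addrK.
have {}E2 : #|~: (I :|: J)|%:R = n%:R - s%:R - k%:R :> R.
  by rewrite -[in RHS]E2 !natrD; ring.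
rewrite E1 E2 /zeta_const.
have -> : 2 + n%:R / 2 + (s%:R - k%:R) / 2 - (n%:R - s%:R - k%:R) / 2 - u =
    1 - u + 1 + s%:R by field.
have -> : 2 + n%:R / 2 + (n%:R - s%:R - k%:R) / 2 - (s%:R - k%:R) / 2 - u =
    1 - u + 1 + n%:R - s%:R by field.
have -> : 2 + n%:R / 2 - (s%:R - k%:R) / 2 - (n%:R - s%:R - k%:R) / 2 - u =
    1 - u + 1 + k%:R by field.
move: (Gamma _) (Gamma _) (Gamma _) (Gamma _) (Gamma _) (Gamma _) => a b c x y z.
by rewrite !invfM /=; ring.
Qed.

Lemma zeta_mul_unit_vec I J :
  (zeta n u *m unit_vec R J) (enum_rank I) 0 = zeta_entry u I J.
Proof.
rewrite mxE (bigD1 (enum_rank J))//= big1 => [|j jJ]; last first.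
  rewrite [X in _ * X]mxE; case: (enum_val j =P J) jJ => [<-|_ _];
    last by rewrite mulr0.
  by rewrite enum_valK eqxx.
by rewrite !mxE !enum_rankK eqxx mulr1 addr0.
Qed.

End ZetaLevels.

Theorem lemma3 (R : realType) (n : nat) (u : R) (d s : nat)
    (A B : {set 'I_n})
    (n_gt0 : (0 < n)%N) (u_lt1 : u < 1)
    (ds : (d <= s <= n - d)%N)
    (cardA : #|A| = d) (cardB : #|B| = d) (disjAB : [disjoint A & B]) :
  is_eigenvector (zeta n u) (lambda n u d) (v_vec R d s A B).
Proof.
have [d_le_s s_le] := andP ds.
have [sigma [sigma_inj sigmaA complE]] :=
  compl_in_matching (etrans cardA (esym cardB)).
set C := ~: (A :|: B).
have cardC : (#|C| + d + d = n)%N.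
  have := cardsC (A :|: B); rewrite cardsU (disjoint_setI0 disjAB) cards0 cardA cardB.
  by rewrite card_ord -/C; lia.
have vE I : v_vec R d s A B (enum_rank I) 0 =
    (#|I| == s)%:R * pair_sign R A sigma I.
  have := sum_supp_set_indicator R disjAB sigma_inj sigmaA (s - d) I.
  rewrite cardA subnKC// => <-.
  rewrite /v_vec summxE; apply: eq_bigr => X XA.
  rewrite summxE; apply: eq_bigr => Y YC.
  by rewrite !mxE enum_rankK (complE X XA).
split.
  (* The summand X = set0 gives a coordinate 1, at B and s - d elements of C. *)
  have : [set Y : {set 'I_n} | Y \subset C & #|Y| == s - d]%N != set0.
    by rewrite -card_gt0 cards_draws bin_gt0; lia.
  case/set0Pn => Y; rewrite inE => /andP[YC /eqP Ys].
  apply/eqP => /matrixP/(_ (enum_rank (B :|: Y)) 0); rewrite vE mxE => /eqP.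
  have BC x : x \in A -> sigma x \in B by move=> xA; rewrite -sigmaA imset_f.
  have -> : #|B :|: Y| = s.
    rewrite cardsU (disjoint_setI0 _) ?cards0 ?cardB ?Ys; first by lia.
    rewrite disjoint_sym disjoints_subset (subset_trans YC)// /C setCU subsetIr.
    exact.
  rewrite eqxx mul1r /pair_sign big1 ?oner_eq0// => a aA.
  rewrite !in_setU BC// (disjointFr disjAB aA) /=.
  have -> : (a \in Y) = false.
    by apply: contraTF aA => /(subsetP YC); rewrite !inE negb_or => /andP[].
  by rewrite subr0.
apply/colP => i; rewrite -(enum_valK i); set I := enum_val i.
have -> : (zeta n u *m v_vec R d s A B) (enum_rank I) 0 =
   \sum_(X : {set 'I_n} | X \subset A)
     \sum_(Y : {set 'I_n} | (Y \subset C) && (#|Y| == s - d)%N)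
       (-1) ^+ #|X| * zeta_entry u I (supp_set B sigma X Y).
  rewrite /v_vec mulmx_sumr summxE; apply: eq_bigr => X XA.
  rewrite mulmx_sumr summxE; apply: eq_bigr => Y YC.
  by rewrite -scalemxAr mxE zeta_mul_unit_vec (complE X XA).
rewrite mxE vE.
have level (X Y : {set 'I_n}) : X \subset A -> Y \subset C -> #|Y| = (s - d)%N ->
    #|supp_set B sigma X Y| = s.
  move=> XA YC Ys.
  by rewrite (card_supp_set disjAB sigma_inj sigmaA XA YC) cardA Ys subnKC.
have [Is|Is] := eqVneq #|I| s; last first.
  rewrite mul0r mulr0 big1// => X XA; rewrite big1// => Y /andP[YC /eqP Ys].
  by rewrite zeta_entry_neq ?mulr0// (level X Y).
rewrite mul1r.
pose f k : R := k`!%:R / Gamma (1 - u + 1 + k%:R).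
pose c : R := zeta_const n u
  * (Gamma (1 - u + 1 + s%:R) * Gamma (1 - u + 1 + n%:R - s%:R)).
transitivity (c * \sum_(X : {set 'I_n} | X \subset A)
     \sum_(Y : {set 'I_n} | (Y \subset C) && (#|Y| == s - d)%N)
       (-1) ^+ #|X| * f #|I :\: supp_set B sigma X Y|).
  rewrite mulr_sumr; apply: eq_bigr => X XA.
  rewrite mulr_sumr; apply: eq_bigr => Y /andP[YC /eqP Ys].
  by rewrite (zeta_entry_level u Is (level X Y XA YC Ys)) mulrCA.
rewrite (sum_supp_set_diff disjAB sigma_inj sigmaA); last by rewrite cardA subnKC.
rewrite -/C cardA mulrCA mulrC; congr (_ * _).
have w0 : 0 < 1 - u by rewrite subr_gt0.
have w1 k : 0 < 1 - u + 1 + k%:R :> R by rewrite ltr_wpDr// addr_gt0.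
have -> : (#|C| - (s - d) = n - s - d)%N by lia.
have regroup (x y : R) N F : x * (F%:R / y) *+ N = x * ((N * F)%:R / y).
  by rewrite -mulr_natr natrM; ring.
under eq_bigr => j _ do
  rewrite (iter_neg_diff_fact (@Gamma_gt0 R) (@GammaS R))// regroup.
rewrite -mulr_sumr.
rewrite (Vandermonde_bin_fact (@Gamma_gt0 R) (@GammaS R)); last exact: w1.
have sd : (s - d)%:R = s%:R - d%:R :> R by rewrite natrB.
have nsd : (n - s - d)%:R = n%:R - s%:R - d%:R :> R.
  by rewrite natrB ?natrB //; lia.
rewrite sd nsd /c /lambda /zeta_const.
have -> : 1 - u + 1 + d%:R + (s%:R - d%:R) + (n%:R - s%:R - d%:R) =
  2 + n%:R - d%:R - u by ring.
have -> : 1 - u + 1 + d%:R + (s%:R - d%:R) = 1 - u + 1 + s%:R by ring.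
have -> : 1 - u + 1 + d%:R + (n%:R - s%:R - d%:R) = 1 - u + 1 + n%:R - s%:R.
  by ring.
have -> : 1 - u + d%:R = 1 + d%:R - u by ring.
have Gs : Gamma (1 - u + 1 + s%:R) != 0 by rewrite gt_eqF ?Gamma_gt0.
have Gn : Gamma (1 - u + 1 + n%:R - s%:R) != 0.
  have -> : 1 - u + 1 + n%:R - s%:R = 1 - u + 1 + (n - s)%:R.
    by rewrite natrB ?addrA//; lia.
  by rewrite gt_eqF ?Gamma_gt0.
move: (Gamma (1 - u + 1 + s%:R)) (Gamma (1 - u + 1 + n%:R - s%:R)) Gs Gn.
move=> x y x0 y0; move: (1 / 2 ^+ n).
move: (Gamma _) (Gamma _) (Gamma _) (Gamma _) (Gamma _) (Gamma _) => *.
by rewrite -[RHS]mulr1 -(divff (mulf_neq0 x0 y0)) !invfM; ring.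
Qed.
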